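(* Let $\lambda = (\lambda_1, \dots , \lambda_r)$ be a partition of $n$ with $\lambda_1\ge 1$, and let $\alpha = (\lambda_2,\dots,\lambda_r)$. Then $$f_{\lambda, n-\lambda_1}(q) = q^{\binom{n-\lambda_1+1}{2}}\, s_{\alpha^\prime}(1,q,\dots,q^{\lambda_1-1}),$$ where $\alpha'$ is the conjugate of $\alpha$. Equivalently, $$f_{\lambda, n-\lambda_1}(q) = q^{\binom{n-\lambda_1+1}{2}} \det\left( \begin{bmatrix} \lambda_1 \\ \lambda_i-i+j \end{bmatrix}_q q^{\binom{\lambda_i-i+j}{2}} \right)_{2 \leq i,j \leq r}.$$
   Context: For a partition $\lambda\vdash N$, a standard Young tableau of shape $\lambda$ is a filling of the Ferrers diagram with $1,\dots,N$, increasing along rows and down columns; it has a descent at $m$ if $m+1$ lies in a strictly lower row than $m$; $\mathrm{des}$ is the number of descents and $\mathrm{maj}$ their sum. $f_{\lambda,i}(q)=\sum q^{\mathrm{maj}(\tau)}$ over standard Young tableaux of shape $\lambda$ with $\mathrm{des}(\tau)=i$. (Note $n-\lambda_1$ is the maximum possible number of descents for shape $\lambda\vdash n$.) The conjugate $\alpha'$ of a partition $\alpha$ has $\alpha'_c$ equal to the number of parts of $\alpha$ that are $\ge c$. $s_\beta(x_1,\dots,x_m)=\sum_T x^T$ is the Schur polynomial, the sum over semistandard Young tableaux $T$ of shape $\beta$ with entries in $\{1,\dots,m\}$ (rows weakly increasing, columns strictly increasing), $x^T=\prod_a x_a^{\#\{a \text{ in } T\}}$. The $q$-binomial coefficient is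 $\frac{(q)_M}{(q)_N(q)_{M-N}}$ for integers $0\le N\le M$ and $0$ otherwise; $\binom{m}{2}=m(m-1)/2$ for all integers $m$. *)

(* Defs.v *)
From HB Require Import structures.
From mathcomp Require Import all_boot all_order all_algebra.
Set Implicit Arguments. Unset Strict Implicit. Unset Printing Implicit Defensive.
Import Order.TTheory GRing.Theory Num.Theory.
Local Open Scope ring_scope.

Definition is_partition (lam : seq nat) (n : nat) : bool :=
  [&& sorted geq lam, all (fun p => 0 < p)%N lam & sumn lam == n].

(* cells of the Ferrers diagram, 0-indexed (row, column) *)
Definition incell (lam : seq nat) (c : nat * nat) : bool :=
  (c.1 < size lam)%N && (c.2 < nth 0 lam c.1)%N.

(* A filling of the grid 'I_K x 'I_K, with value 0 outside the diagram. *)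
Definition grid (K : nat) := ('I_K * 'I_K)%type.
Definition cellc {K} (c : grid K) : nat * nat := (val c.1, val c.2).

Definition isSYT (lam : seq nat) (T : {ffun grid (sumn lam) -> 'I_(sumn lam).+1}) : bool :=
  [&& [forall c, ~~ incell lam (cellc c) ==> (val (T c) == 0%N)],
      [forall c, incell lam (cellc c) ==> (0 < val (T c))%N],
      [forall c, forall d, [&& incell lam (cellc c), incell lam (cellc d)
                              & T c == T d] ==> (c == d)],
      [forall m : 'I_(sumn lam).+1, (0 < val m)%N ==>
            [exists c, incell lam (cellc c) && (T c == m)]],
      [forall c, forall d, [&& incell lam (cellc c), incell lam (cellc d),
                             val c.1 == val d.1 & (val c.2 < val d.2)%N]
                             ==> (val (T c) < val (T d))%N]
    & [forall c, forall d, [&& incell lam (cellc c), incell lam (cellc d),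
                             val c.2 == val d.2 & (val c.1 < val d.1)%N]
                             ==> (val (T c) < val (T d))%N]].

Arguments isSYT : clear implicits.

Definition rowof {K M} (T : {ffun grid K -> 'I_M}) (m : nat) : nat :=
  if [pick c | val (T c) == m] is Some c then val c.1 else 0%N.

Definition descents {K M} (N : nat) (T : {ffun grid K -> 'I_M}) : seq nat :=
  [seq m <- iota 1 N.-1 | (rowof T m < rowof T m.+1)%N].

Definition des {K M} N (T : {ffun grid K -> 'I_M}) : nat := size (descents N T).
Definition maj {K M} N (T : {ffun grid K -> 'I_M}) : nat := sumn (descents N T).

Definition f_poly (lam : seq nat) (i : nat) : {poly int} :=
  \sum_(T : {ffun grid (sumn lam) -> 'I_(sumn lam).+1}
          | isSYT lam T && (des (sumn lam) T == i)) 'X^(maj (sumn lam) T).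

Definition isSSYT (beta : seq nat) (m : nat)
    (T : {ffun grid (sumn beta) -> 'I_m.+1}) : bool :=
  [&& [forall c, ~~ incell beta (cellc c) ==> (val (T c) == 0%N)],
      [forall c, incell beta (cellc c) ==> (0 < val (T c))%N],
      [forall c, forall d, [&& incell beta (cellc c), incell beta (cellc d),
                             val c.1 == val d.1 & (val c.2 < val d.2)%N]
                             ==> (val (T c) <= val (T d))%N]
    & [forall c, forall d, [&& incell beta (cellc c), incell beta (cellc d),
                             val c.2 == val d.2 & (val c.1 < val d.1)%N]
                             ==> (val (T c) < val (T d))%N]].

Arguments isSSYT : clear implicits.

(* s_beta(x_1,...,x_m) evaluated at x_a := x a, in a commutative ring *)
Definition schur (R : comNzRingType) (beta : seq nat) (m : nat) (x : nat -> R) : R :=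
  \sum_(T : {ffun grid (sumn beta) -> 'I_m.+1} | isSSYT beta m T)
     \prod_(c : grid (sumn beta) | incell beta (cellc c)) x (val (T c)).

Definition conjugate (a : seq nat) : seq nat :=
  mkseq (fun c => count (fun p => c < p)%N a) (foldr maxn 0%N a).

Definition qpoch (M : nat) : {poly int} := \prod_(1 <= k < M.+1) (1 - 'X^k).
Definition qbinom (M : nat) (N : int) : {poly int} :=
  if (0 <= N) && (N <= M%:Z) then
    qpoch M %/ (qpoch `|N|%N * qpoch (M - `|N|)%N)
  else 0.

(* binom(m,2) = m(m-1)/2 for an integer m (always a natural number) *)
Definition binom2z (m : int) : nat := (`|(m * (m - 1))%R|%N %/ 2)%N.

(* the (r-1)x(r-1) matrix with indices 2 <= i,j <= r shifted to 0-based *)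
Definition detmx (lam : seq nat) : 'M[{poly int}]_((size lam).-1) :=
  \matrix_(i, j)
    (let e : int := (nth 0%N lam i.+1)%:Z - (i : nat)%:Z + (j : nat)%:Z in
     qbinom (head 0%N lam) e * 'X^(binom2z e)).

(* Main.v *)
Require Import Defs.
From HB Require Import structures.
From mathcomp Require Import all_boot all_order all_algebra.
From mathcomp Require Import perm zify ring.
Import Order.TTheory GRing.Theory Num.Theory.
Set Implicit Arguments. Unset Strict Implicit. Unset Printing Implicit Defensive.
Local Open Scope ring_scope.

(** Both sides are compared with the generating function of row-strict,
    column-weak fillings S of alpha with entries in [1, lam_1], i.e. transposed
    semistandard tableaux of shape alpha'.

    A standard tableau T has n - lam_1 descents iff every entry outside the first
    row lies strictly below its predecessor.  The first-row entries cut 1, ..., n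
    into lam_1 segments, inside which rows then strictly increase; replacing
    each entry by the number of its segment gives S, and standardizing S
    (extended by the first row 1, ..., lam_1) with respect to (entry, row)
    recovers T.  An entry of T below the first row is its segment number plus
    its rank among such entries, whence the factor q^binom(n - lam_1 + 1, 2).

    The determinant is obtained by induction on the number m of variables.
    Removing the entries m+1 from S removes a vertical strip; on the other side
    e_k(m+1) = e_k(m) + q^m e_(k-1)(m) expands the determinant over all 0/1
    vectors e, and the terms in which alpha - e is not a partition have two equal
    adjacent rows or a zero last row. *)

(** * Gaussian binomials *)

(** The q-Pascal recurrence stands in for the polynomial division of [qbinom]. Where [m' - k']
    truncates, the factor [gauss m' k'] vanishes. *)
Fixpoint gauss (m k : nat) : {poly int} :=
  match m, k with
  | _, 0%N => 1
  | 0%N, _.+1 => 0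
  | m'.+1, k'.+1 => gauss m' k'.+1 + 'X^(m' - k') * gauss m' k'
  end.

Lemma gauss0 m : gauss m 0 = 1. Proof. by case: m. Qed.

Lemma gauss_small m k : (m < k)%N -> gauss m k = 0.
Proof.
elim: m k => [|m IH] [|k] //= filling.
by rewrite !IH ?mulr0 ?addr0 //; lia.
Qed.

Lemma qpochS m : qpoch m.+1 = qpoch m * (1 - 'X^(m.+1)).
Proof. by rewrite /qpoch big_nat_recr. Qed.

Lemma gauss_qpoch m k : (k <= m)%N ->
  gauss m k * (qpoch k * qpoch (m - k)) = qpoch m.
Proof.
have q0 : qpoch 0 = 1 by rewrite /qpoch big_geq.
elim: m k => [|m IH] [|k] //= km; rewrite ?subn0 ?mul1r ?q0 ?mul1r //.
rewrite subSS mulrDl qpochS.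
have IHk := IH k km.
(* The factor 1 - q^(m+1) is split so as to match the two terms of the q-Pascal rule. *)
have -> : qpoch m.+1 = qpoch m * (1 - 'X^(m - k)) +
            'X^(m - k) * (qpoch m * (1 - 'X^(k.+1))).
  have E : 'X^(m.+1) = 'X^(m - k) * 'X^(k.+1) :> {poly int}.
    by rewrite -exprD; congr ('X^_); lia.
  by rewrite qpochS E; ring.
congr (_ + _); last by rewrite -IHk; ring.
have [filling|filling] := ltnP k m; last first.
  have -> : k = m by lia.
  by rewrite gauss_small // subnn expr0 subrr mulr0 mul0r.
rewrite -(IH k.+1 filling) qpochS.
have -> : (m - k = (m - k.+1).+1)%N by lia.
rewrite qpochS; ring.
Qed.

(** Over the integers, [%/] cancels a factor whose leading coefficient is a unit; here it is a
    sign. *)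
Lemma lead_coef_qpoch m : lead_coef (qpoch m) = (- 1) ^+ m.
Proof.
elim: m => [|m IH]; first by rewrite /qpoch big_geq // lead_coef1.
rewrite qpochS lead_coefM IH [RHS]exprSr; congr (_ * _).
rewrite -opprB lead_coefN; congr (- _); apply/eqP.
by have := monicXnsubC (1 : int) (ltn0Sn m); rewrite monicE polyC1.
Qed.

Lemma qbinom_gauss m k : qbinom m (Posz k) = gauss m k.
Proof.
rewrite /qbinom lez_nat /=.
case: leqP => [km|filling]; last by rewrite gauss_small.
rewrite -{1}(gauss_qpoch km) Pdiv.IdomainUnit.mulpK // lead_coefM !lead_coef_qpoch.
by rewrite -exprD unitrX // unitrN1.
Qed.

Lemma qbinom_neg m k : k < 0 -> qbinom m k = 0.
Proof. by rewrite /qbinom ltNge => /negbTE ->. Qed.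

(* Principal specialization e_k(1, q, ..., q^(m-1)) of the elementary
   symmetric polynomials, extended by 0 to negative k. *)
Fixpoint qelem (m : nat) (k : int) : {poly int} :=
  if m is m'.+1 then qelem m' k + 'X^m' * qelem m' (k - 1) else (k == 0)%:R.

Lemma qelem_neg m k : k < 0 -> qelem m k = 0.
Proof.
elim: m k => [|m IH] k k0 /=; first by rewrite lt_eqF.
by rewrite !IH ?mulr0 ?addr0 //; lia.
Qed.

Lemma binom2z_nat k : binom2z (Posz k) = 'C(k, 2).
Proof.
rewrite /binom2z bin2 -divn2; congr (_ %/ 2)%N; case: k => [|k] //.
by rewrite abszM; congr (_ * _)%N; lia.
Qed.

(** The q-binomial theorem, coefficientwise. In the induction the new variable q^m splits into the
    q-Pascal weight q^(m-k) and the factor q^k by which q^binom(k,2) grows. *)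
Lemma qelemE m k : qelem m k = qbinom m k * 'X^(binom2z k).
Proof.
case: (ltrP k 0) => [k0|]; first by rewrite qelem_neg // qbinom_neg // mul0r.
case: k => // k _; rewrite qbinom_gauss binom2z_nat.
elim: m k => [|m IH] [|k] //=.
- by rewrite mul1r.
- by rewrite mul0r.
- by rewrite IH qelem_neg // gauss0 mulr0 addr0.
have -> : Posz k.+1 - 1 = Posz k by lia.
rewrite !IH mulrDl; congr (_ + _).
have [filling|km] := ltnP m k; first by rewrite gauss_small // !(mul0r, mulr0).
have -> : 'X^m = 'X^(m - k) * 'X^k :> {poly int} by rewrite -exprD subnK.
rewrite binS bin1 exprD; ring.
Qed.

(** * Branching and the dual Jacobi-Trudi determinant *)

(** Shapes are functions on a fixed index set: rows may become empty as strips are removed, while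
    the determinant keeps its size. *)
Definition wdec r (a : 'I_r -> nat) : bool :=
  [forall i : 'I_r, forall j : 'I_r, (i <= j)%N ==> (a j <= a i)%N].

Lemma wdecP r (a : 'I_r -> nat) :
  reflect (forall i j : 'I_r, (i <= j)%N -> (a j <= a i)%N) (wdec a).
Proof.
apply: (iffP forallP) => [H i j ij|H i]; first exact: (implyP (forallP (H i) j)).
by apply/forallP => j; apply/implyP/H.
Qed.

Lemma wdec_adj r (a : 'I_r -> nat) :
  (forall i j : 'I_r, j = i.+1 :> nat -> (a j <= a i)%N) -> wdec a.
Proof.
move=> H; apply/wdecP => i j.
have [k] := ubnP (j - i)%N; elim: k j => // k IH j jk ij.
case: (eqVneq (i : nat) j) => [/val_inj -> //|ne].
have lt : (j.-1 < r)%N by have := ltn_ord j; lia.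
by apply: (leq_trans (H (Ordinal lt) j _)) => [|]; [|apply: IH]; rewrite /=; lia.
Qed.

(* Transposes of semistandard tableaux; cells outside the shape hold 0. *)
Definition rstab r B M (m : nat) (a : 'I_r -> nat)
    (T : {ffun 'I_r * 'I_B -> 'I_M.+1}) : bool :=
  [&& [forall i, forall c : 'I_B,
         if (c < a i)%N then (0 < T (i, c) <= m)%N else T (i, c) == 0%N :> nat],
      [forall i, forall c : 'I_B, forall d : 'I_B,
         (c < d < a i)%N ==> (T (i, c) < T (i, d))%N]
    & [forall i : 'I_r, forall j : 'I_r, forall c : 'I_B,
         (i < j)%N && (c < a j)%N ==> (T (i, c) <= T (j, c))%N]].

Lemma rstabP r B M m (a : 'I_r -> nat) (T : {ffun 'I_r * 'I_B -> 'I_M.+1}) :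
  reflect
   [/\ forall i (c : 'I_B), (c < a i)%N -> (0 < T (i, c) <= m)%N,
       forall i (c : 'I_B), (a i <= c)%N -> T (i, c) = 0%N :> nat,
       forall i (c d : 'I_B), (c < d)%N -> (d < a i)%N -> (T (i, c) < T (i, d))%N
     & forall (i j : 'I_r) (c : 'I_B), (i < j)%N -> (c < a j)%N -> (T (i, c) <= T (j, c))%N]
   (rstab m a T).
Proof.
apply: (iffP and3P) => [[/forallP H1 /forallP H2 /forallP H3]|[H1 H2 H3 H4]]; split.
- by move=> i c ca; have /forallP/(_ c) := H1 i; rewrite ca.
- by move=> i c ca; have /forallP/(_ c) := H1 i; rewrite ltnNge ca => /eqP.
- move=> i c d cd da; have /forallP/(_ c)/forallP/(_ d) := H2 i.
  by rewrite cd da.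
- move=> i j c ij cj; have /forallP/(_ j)/forallP/(_ c) := H3 i.
  by rewrite ij cj.
- apply/forallP => i; apply/forallP => c; case: ltnP => ca; first exact: H1.
  by apply/eqP/H2.
- apply/forallP => i; apply/forallP => c; apply/forallP => d.
  by apply/implyP => /andP [cd da]; apply: H3.
- apply/forallP => i; apply/forallP => c; apply/forallP => d.
  by apply/implyP => /andP [cd da]; apply: H4.
Qed.

(** [B] and [M] fix the type of the fillings while [m] and [a] vary in the induction. Cells outside
    the shape hold 0 and add [0.-1 = 0] to the exponent. *)
Definition rstab_sum r B M (m : nat) (a : 'I_r -> nat) : {poly int} :=
  \sum_(T : {ffun 'I_r * 'I_B -> 'I_M.+1} | rstab m a T)
    'X^(\sum_c (T c).-1).

(** The positivity condition forbids removing a cell from an empty row, which truncated subtraction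
    would hide. *)
Definition vstrip r (a : 'I_r -> nat) (e : {ffun 'I_r -> bool}) : bool :=
  [forall i, e i ==> (0 < a i)%N] && wdec (fun i => a i - e i)%N.

Lemma ltn_subb (c n : nat) (e : bool) :
  (c < n)%N -> (e && (c.+1 == n)) = false -> (c < n - e)%N.
Proof. by case: e => cn /=; [move/negbT/eqP; lia | rewrite subn0]. Qed.

(** Strict rows contain m+1 at most once, at their right end. Erasing these entries ([del]) and
    restoring them ([add]) are inverse to each other once the strip [e] is fixed, and each such
    entry has weight q^m. *)
Lemma rstab_sumS r B M m (a : 'I_r -> nat) : (m < M)%N ->
  wdec a -> (forall i, a i <= B)%N ->
  rstab_sum B M m.+1 a =
  \sum_(e | vstrip a e) 'X^(m * \sum_i e i) * rstab_sum B M m (fun i => a i - e i)%N.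
Proof.
move=> mM /wdecP wa aB; rewrite /rstab_sum.
pose strip (T : {ffun 'I_r * 'I_B -> 'I_M.+1}) : {ffun 'I_r -> bool} :=
  [ffun i => [exists c, T (i, c) == m.+1 :> nat]].
(* in a row of [T], the entry m+1 can only sit in the last cell *)
have lastc T (i : 'I_r) (c : 'I_B) : rstab m.+1 a T ->
    (T (i, c) == m.+1 :> nat) = strip T i && (c.+1 == a i).
  case/rstabP=> H1 H2 H3 H4.
  have only (d : 'I_B) : T (i, d) = m.+1 :> nat -> d.+1 = a i.
    move=> Td; have da : (d < a i)%N.
      by rewrite ltnNge; apply/negP => /H2; rewrite Td.
    apply/eqP; rewrite eqn_leq da leqNgt; apply/negP => lt.
    have lB : (d.+1 < B)%N := leq_trans lt (aB i).
    have := H3 i d (Ordinal lB) (ltnSn _) lt.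
    by have /andP [_] := H1 i (Ordinal lB) lt; rewrite Td; lia.
  apply/eqP/andP => [Tc|[]].
    by split; [rewrite ffunE; apply/existsP; exists c; apply/eqP|apply/eqP/only].
  rewrite ffunE => /existsP [d /eqP Td] /eqP cd.
  have -> // : c = d by apply: val_inj; have := only _ Td; rewrite -cd => -[].
rewrite (partition_big strip (vstrip a)) => [|T tT] /=; last first.
  have [H1 H2 H3 H4] := rstabP _ _ _ tT.
  have sP i : strip T i -> exists2 c : 'I_B, T (i, c) = m.+1 :> nat & c.+1 = a i.
    move=> si; have := si; rewrite ffunE => /existsP [c Tc]; exists c; first exact/eqP.
    by move: Tc; rewrite lastc // => /andP [_ /eqP].
  apply/andP; split; first by apply/forallP => i; apply/implyP => /sP [c _ <-].
  apply/wdecP => i j ij; have := wa i j ij.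
  case si: (strip T i); last by rewrite subn0; apply/leq_trans/leq_subr.
  have [c Tc ca] := sP i si.
  (* Only rows of equal length could break the shape; there, weak columns force m+1 at the end of
     the lower row too. *)
  rewrite leq_eqVlt => /orP [/eqP aij|]; last by lia.
  suff -> : strip T j by lia.
  rewrite ffunE; apply/existsP; exists c; apply/eqP.
  move: ij; rewrite leq_eqVlt => /orP [/eqP/val_inj <- //|ij].
  have caj : (c < a j)%N by lia.
  apply/eqP; rewrite eqn_leq; apply/andP; split; first by case/andP: (H1 j c caj).
  by rewrite -Tc; apply: H4.
apply: eq_bigr => e /andP [/forallP e0 /wdecP we].
rewrite big_distrr /=.
pose add (S : {ffun 'I_r * 'I_B -> 'I_M.+1}) : {ffun 'I_r * 'I_B -> 'I_M.+1} :=
  [ffun c : 'I_r * 'I_B => if e c.1 && (c.2.+1 == a c.1) then inord m.+1 else S c].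
pose del (S : {ffun 'I_r * 'I_B -> 'I_M.+1}) : {ffun 'I_r * 'I_B -> 'I_M.+1} :=
  [ffun c : 'I_r * 'I_B => if S c == m.+1 :> nat then ord0 else S c].
have addE S (i : 'I_r) (c : 'I_B) :
    add S (i, c) = (if e i && (c.+1 == a i) then m.+1 else S (i, c)) :> nat.
  by rewrite ffunE /=; case: ifP => // _; rewrite inordK.
have delE S (i : 'I_r) (c : 'I_B) :
    del S (i, c) = (if S (i, c) == m.+1 :> nat then 0%N else S (i, c)) :> nat.
  by rewrite ffunE /=; case: ifP.
have e1 i : e i -> (0 < a i)%N by apply/implyP.
rewrite (reindex_onto add del) /= => [|T /andP [tT /eqP sT]]; last first.
  apply/ffunP => -[i c]; apply: val_inj; rewrite /= addE delE.
  by rewrite -sT -lastc //; case: eqP => [->|].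
have rstabE S : [&& rstab m.+1 a (add S), strip (add S) == e & del (add S) == S]
    = rstab m (fun i => a i - e i)%N S.
  apply/and3P/rstabP => [[tA /eqP sA /eqP dA]|[H1 H2 H3 H4]].
    have [H1 H2 H3 H4] := rstabP _ _ _ tA.
    have SE (i : 'I_r) (c : 'I_B) :
        S (i, c) = (if e i && (c.+1 == a i) then 0%N else add S (i, c)) :> nat.
      by rewrite -[in LHS]dA delE lastc // sA.
    have A1 (i : 'I_r) (c : 'I_B) : (c < a i - e i)%N -> S (i, c) = add S (i, c).
      by move=> ca; apply: val_inj; rewrite /= SE; case: (e i) ca => //=; case: eqP => //; lia.
    split=> [i c ca|i c ca|i c d cd da|i j c ij ca].
    - have := A1 i c ca => E; have := H1 i c; rewrite -E.
      have : S (i, c) != m.+1 :> nat.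
        by rewrite E lastc // sA; move: ca; case: (e i) => //=; lia.
      lia.
    - rewrite SE; case: ifP => // ei; apply: H2; move: ei ca; case: (e i) => /=; lia.
    - by rewrite !A1; [apply: H3| |]; lia.
    - by rewrite !A1; [apply: H4| |have := we i j]; lia.
  have S0 (i : 'I_r) (c : 'I_B) : e i && (c.+1 == a i) -> S (i, c) = 0%N :> nat.
    by case/andP=> ei /eqP ca; apply: H2; rewrite ei; lia.
  have Sm (i : 'I_r) (c : 'I_B) : (S (i, c) <= m)%N.
    case: (ltnP c (a i - e i)) => ca; first by case/andP: (H1 i c ca).
    by rewrite H2.
  have addm (i : 'I_r) (c : 'I_B) : (add S (i, c) == m.+1 :> nat) = e i && (c.+1 == a i).
    by rewrite addE; case: ifP => _; rewrite ?eqxx // ltn_eqF // ltnS.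
  split.
  - apply/rstabP; split=> [i c ca|i c ca|i c d cd da|i j c ij ca]; rewrite ?addE.
    + case: ifP => ei; first by rewrite leqnn.
      have ce := ltn_subb ca ei.
      by have := H1 i c ce; lia.
    + rewrite H2; last by lia.
      by case: ifP => // /andP [_ /eqP]; lia.
    + have -> : (e i && (c.+1 == a i)) = false by apply/negP => /andP [_ /eqP]; lia.
      case: ifP => [_|ei]; first by rewrite ltnS.
      by apply: H3 => //; apply: ltn_subb.
    + case: (boolP (e j && _)) => [_|/negbTE nj].
        by case: ifP => // _; apply: leq_trans (Sm _ _) _.
      have ce := ltn_subb ca nj.
      have := we i j (ltnW ij) => wij.
      (* A removed cell has no remaining cell below it, since the remaining row lengths decrease
         weakly. *)
      case: ifP => [/andP [ei /eqP ci]|_]; last exact: H4.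
      by move: wij; rewrite ei; lia.
  - apply/eqP/ffunP => i; rewrite ffunE; apply/existsP/idP => [[c]|ei].
      by rewrite addm => /andP [].
    have lB : ((a i).-1 < B)%N by have := aB i; have := e1 i ei; lia.
    by exists (Ordinal lB); rewrite addm ei /= prednK ?eqxx // e1.
  - apply/eqP/ffunP => -[i c]; apply: val_inj; rewrite /= delE addm addE.
    by case: ifP => [/S0 ->|->].
apply: eq_big => [S|S]; first by rewrite -rstabE -andbA.
rewrite -andbA rstabE => /rstabP [H1 H2 _ _].
have sumE (U : {ffun 'I_r * 'I_B -> 'I_M.+1}) :
    (\sum_c (U c).-1 = \sum_i \sum_c (U (i, c)).-1)%N.
  by rewrite pair_bigA; apply: eq_bigr => -[].
rewrite -exprD; congr ('X^_); rewrite big_distrr /= !sumE.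
rewrite -big_split /=; apply: eq_bigr => i _.
case ei: (e i); last by rewrite muln0; apply: eq_bigr => c _; rewrite addE ei.
have lB : ((a i).-1 < B)%N by have := aB i; have := e1 i ei; lia.
(* In a strip row, the last cell holds m+1 on one side and 0 on the other, which accounts for the
   factor q^m. *)
rewrite (bigD1 (Ordinal lB)) //= [in RHS](bigD1 (Ordinal lB)) //= addE ei /=.
rewrite prednK ?e1 // eqxx H2 /=; last by rewrite ei; lia.
rewrite muln1 add0n; congr (_ + _)%N; apply: eq_bigr => c; rewrite addE ei /= => nc.
case: ifP => // /eqP ca; case/eqP: nc; apply: val_inj => /=; lia.
Qed.

(** Row lengths are integers because the expansion over 0/1 vectors also produces the length -1. *)
Definition qdet m r (a : 'I_r -> int) : {poly int} :=
  \det (\matrix_(i < r, j < r) qelem m (a i - (i : nat)%:Z + (j : nat)%:Z)).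

Lemma eq_qdet m r (a b : 'I_r -> int) : a =1 b -> qdet m a = qdet m b.
Proof. by move=> ab; congr (\det _); apply/matrixP => i j; rewrite !mxE ab. Qed.

(** Multilinearity in the rows: in each term of the Leibniz formula, the product over rows of
    two-term sums is distributed into a sum over [e]. *)
Lemma qdetS m r (a : 'I_r -> int) :
  qdet m.+1 a = \sum_(e : {ffun 'I_r -> bool})
    'X^(m * \sum_i e i) * qdet m (fun i => a i - (nat_of_bool (e i))%:Z).
Proof.
rewrite /qdet /determinant.
under [RHS]eq_bigr => e _ do rewrite big_distrr /=.
rewrite exchange_big /=; apply: eq_bigr => s _.
pose F (i : 'I_r) (b : bool) : {poly int} :=
  'X^(m * b) * qelem m (a i - (nat_of_bool b)%:Z - (i : nat)%:Z + (s i : nat)%:Z).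
transitivity ((-1) ^+ s * \prod_i \sum_(b : bool) F i b).
  congr (_ * _); apply: eq_bigr => i _; rewrite mxE big_bool /F /= muln0 muln1 expr0 mul1r.
  rewrite [LHS]addrC; congr (_ + _); [congr (_ * _)|]; congr (qelem _ _); lia.
rewrite bigA_distr_bigA /= big_distrr; apply: eq_bigr => e _ /=.
rewrite mulrCA; congr (_ * _); rewrite /F big_split /=; congr (_ * _).
  by rewrite -expr_sum big_distrr.
by apply: eq_bigr => i _; rewrite mxE.
Qed.

(** The values a_i - i and a_j - j agree, so the two rows coincide. *)
Lemma qdet_adj0 m r (a : 'I_r -> int) (i j : 'I_r) :
  j = i.+1 :> nat -> a j = a i + 1 -> qdet m a = 0.
Proof.
move=> ij aij; apply: (determinant_alternate (i1 := i) (i2 := j)).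
  by apply/eqP => E; move: ij; rewrite E; lia.
by move=> k; rewrite !mxE aij ij; congr (qelem _ _); lia.
Qed.

(** In the last row the column index never exceeds the row index, so every degree there is
    negative. *)
Lemma qdet_last0 m r (a : 'I_r -> int) (i : 'I_r) :
  i.+1 = r -> a i < 0 -> qdet m a = 0.
Proof.
move=> ir ai; rewrite /qdet (expand_det_row _ i) big1 // => j _.
by rewrite mxE qelem_neg ?mul0r //; have := ltn_ord j; lia.
Qed.

(* A violation of [vstrip] yields either two equal adjacent rows or a zero last row. *)
Lemma qdet_vstrip m r (a : 'I_r -> nat) (e : {ffun 'I_r -> bool}) :
  wdec a -> ~~ vstrip a e ->
  qdet m (fun i => (a i)%:Z - (nat_of_bool (e i))%:Z) = 0.
Proof.
move=> /wdecP wa; rewrite negb_and => /orP [|nwd].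
  rewrite negb_forall => /existsP [i0]; rewrite negb_imply -eqn0Ngt => bad.
  (* Take the lowest empty row from which a cell is removed. Either it is the last row, of length
     -1, or by maximality the next row keeps length 0 = -1 + 1. *)
  case: (arg_maxnP (P := fun i : 'I_r => e i && (a i == 0%N)) (fun i : 'I_r => i : nat) bad) => i.
  case/andP=> ei /eqP ai imax.
  case: (eqVneq i.+1 r) => [ir|ne].
    by apply: (@qdet_last0 _ _ _ i) => //; rewrite ei ai.
  have lt : (i.+1 < r)%N by have := ltn_ord i; lia.
  pose j := Ordinal lt.
  have aj : a j = 0%N by have := wa i j (leqnSn _); rewrite ai; lia.
  apply: (@qdet_adj0 _ _ _ i j) => //; rewrite ei ai aj.
  case ej: (e j) => //; have := imax j; rewrite ej aj => /(_ isT) /=.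
  by rewrite ltnn.
(* An ascent between adjacent rows means a_i = a_j, with a cell removed from the upper row only. *)
have [[i j] /= /andP [/eqP ij lt]|ok] :=
    pickP (fun p : 'I_r * 'I_r => (p.2 == p.1.+1 :> nat) && (a p.1 - e p.1 < a p.2 - e p.2)%N).
  apply: (@qdet_adj0 _ _ _ i j) => //.
  have ij' : (i <= j)%N by rewrite ij.
  by have := wa i j ij'; move: lt; case: (e i); case: (e j); lia.
case/negP: nwd; apply: wdec_adj => i j /eqP ij.
by have := ok (i, j); rewrite /= ij /= ltnNge => /negbFE.
Qed.

Theorem rstab_sum_det r B M m (a : 'I_r -> nat) : (m <= M)%N ->
  wdec a -> (forall i, a i <= B)%N ->
  rstab_sum B M m a = qdet m (fun i => (a i)%:Z).
Proof.
elim: m a => [|m IH] a mM wa aB; last first.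
  rewrite rstab_sumS // qdetS [RHS](bigID (vstrip a)) /= [X in _ + X]big1 ?addr0.
    apply: eq_bigr => e /andP [/forallP e0 we]; congr (_ * _).
    rewrite IH //; last 2 first.
    - by rewrite ltnW.
    - by move=> i; apply: leq_trans (leq_subr _ _) (aB i).
    apply: eq_qdet => i; have := implyP (e0 i).
    by case: (e i) => [/(_ isT)|_]; lia.
  by move=> e ne; rewrite qdet_vstrip ?mulr0.
(* With no variables, an entry is nonzero only if a_i = i - j, so the matrix is lower triangular
   with diagonal 1 or 0 according as a_i = 0. Both sides are thus 1 for the empty shape and 0
   otherwise. *)
have trig : is_trig_mx (\matrix_(i < r, j < r)
    qelem 0 ((a i)%:Z - (i : nat)%:Z + (j : nat)%:Z)).
  apply/is_trig_mxP => i j ij; rewrite mxE /=; case: eqP => //; lia.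
rewrite /qdet (det_trig trig).
have [a0|na] := boolP [forall i, a i == 0%N].
  rewrite (eq_bigr (fun=> 1)) => [|i _]; last first.
    by rewrite mxE /= (eqP (forallP a0 i)) sub0r addrC subrr.
  rewrite big1 // /rstab_sum (big_pred1 [ffun=> ord0]) => [|T].
    by rewrite big1 // => c _; rewrite ffunE.
  apply/rstabP/eqP => [[_ H2 _ _]|->]; last first.
    by split=> [i c|i c _|i c d|i j c]; rewrite ?ffunE // (eqP (forallP a0 _)).
  apply/ffunP => -[i c]; apply: val_inj; rewrite ffunE /= H2 //.
  by rewrite (eqP (forallP a0 i)).
have [i ai] : exists i, a i != 0%N by apply/existsP; rewrite -negb_forall.
rewrite (bigD1 i) //= mxE /= subrK eqz_nat (negbTE ai) mul0r.
rewrite /rstab_sum big_pred0 // => T; apply/rstabP => -[H1 _ _ _].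
have lB : (0 < B)%N by have := aB i; lia.
have a0 : (0 < a i)%N by rewrite lt0n.
by have /andP [/leq_trans H /H] := H1 i (Ordinal lB) a0.
Qed.

(** * Transposition of semistandard tableaux *)

(** Reading finite fillings as total functions, 0 off the grid, allows comparison between grids of
    different sizes. *)
Definition entry K L N (T : {ffun 'I_K * 'I_L -> 'I_N}) (i j : nat) : nat :=
  if (insub i, insub j) is (Some i', Some j') then T (i', j') else 0%N.

Definition filling K L N (g : nat -> nat -> nat) : {ffun 'I_K * 'I_L -> 'I_N.+1} :=
  [ffun c : 'I_K * 'I_L => inord (g c.1 c.2)].

Lemma entryE K L N (T : {ffun 'I_K * 'I_L -> 'I_N}) (i : 'I_K) (j : 'I_L) :
  entry T i j = T (i, j).
Proof. by rewrite /entry !valK. Qed.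

Lemma entry_out K L N (T : {ffun 'I_K * 'I_L -> 'I_N}) i j :
  ~~ ((i < K)%N && (j < L)%N) -> entry T i j = 0%N.
Proof.
by rewrite /entry; case: insubP => // u -> _ /=; case: insubP => // v ->.
Qed.

Lemma entry_filling K L N g i j : (i < K)%N -> (j < L)%N -> (g i j <= N)%N ->
  entry (filling K L N g) i j = g i j.
Proof.
move=> iK jL gN; rewrite -[i in LHS]/(val (Ordinal iK)) -[j in LHS]/(val (Ordinal jL)).
by rewrite entryE ffunE inordK.
Qed.

Lemma entry_le K L N (T : {ffun 'I_K * 'I_L -> 'I_N.+1}) i j : (entry T i j <= N)%N.
Proof. by rewrite /entry; case: insub => // u; case: insub => // v; rewrite -ltnS. Qed.

Lemma filling_entry K L N (T : {ffun 'I_K * 'I_L -> 'I_N.+1}) g :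
  (forall i j, (i < K)%N -> (j < L)%N -> g i j = entry T i j) -> filling K L N g = T.
Proof.
by move=> gT; apply/ffunP => -[i j]; rewrite ffunE /= gT // entryE inord_val.
Qed.

Lemma sum_ord_eqn K K' (G G' : nat -> nat) : G =1 G' ->
  (forall i, (K <= i)%N -> G i = 0%N) -> (forall i, (K' <= i)%N -> G i = 0%N) ->
  (\sum_(i < K) G i = \sum_(i < K') G' i)%N.
Proof.
move=> GG'; under [in RHS]eq_bigr => i _ do rewrite -GG'.
wlog le : K K' / (K <= K')%N => [H|] K0 K0'.
  by case: (leqP K K') => [|/ltnW] le; [|symmetry]; apply: H.
rewrite (big_ord_widen K' G le) [RHS](bigID (fun i : 'I_K' => (i < K)%N)) /=.
by rewrite [X in (_ + X)%N]big1 ?addn0 // => i; rewrite -leqNgt => /K0.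
Qed.

(* Both [isSSYT] of a conjugate shape and [rstab] are expressed on functions of
   (row, column) in the coordinates of [rstab]; [L] is the set of cells. *)
Definition rs_fun (L : nat -> nat -> bool) (m : nat) (g : nat -> nat -> nat) : Prop :=
  [/\ forall i c, ~~ L i c -> g i c = 0%N,
      forall i c, L i c -> (0 < g i c <= m)%N,
      forall i c d, (c < d)%N -> L i d -> (g i c < g i d)%N
    & forall i j c, (i < j)%N -> L j c -> (g i c <= g j c)%N].

Lemma eq_rs_fun L m g h : (forall i j, g i j = h i j) -> rs_fun L m g -> rs_fun L m h.
Proof. by move=> gh [H1 H2 H3 H4]; split=> *; rewrite -!gh; auto. Qed.

Definition inshape (a : seq nat) (i c : nat) : bool := (c < nth 0%N a i)%N.

Lemma geq_trans : transitive geq.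
Proof. by move=> x y z /= yx xz; apply: leq_trans xz yx. Qed.

Lemma sorted_geq_nth a i j : sorted geq a -> (i <= j)%N -> (nth 0 a j <= nth 0 a i)%N.
Proof.
move=> sa ij; case: (ltnP j (size a)) => ja; last by rewrite nth_default.
apply: (sorted_leq_nth geq_trans leqnn 0%N sa i j _ _ ij); rewrite inE //.
exact: leq_ltn_trans ja.
Qed.

Lemma inshape_up lam i j c : sorted geq lam -> (i <= j)%N -> inshape lam j c -> inshape lam i c.
Proof. by move=> sl ij cj; apply: leq_trans cj (sorted_geq_nth sl ij). Qed.

Lemma inshape_left lam i c d : (c <= d)%N -> inshape lam i d -> inshape lam i c.
Proof. exact: leq_ltn_trans. Qed.

Lemma rstab_rs_fun (a : seq nat) B M m (S : {ffun 'I_(size a) * 'I_B -> 'I_M.+1}) :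
  sorted geq a -> (nth 0 a 0 <= B)%N ->
  reflect (rs_fun (inshape a) m (entry S)) (rstab m (fun i => nth 0%N a i) S).
Proof.
move=> sa aB.
have inL i c : inshape a i c -> (i < size a)%N /\ (c < B)%N.
  rewrite /inshape => ci; split.
    by rewrite ltnNge; apply/negP => le; move: ci; rewrite nth_default.
  by apply: leq_trans ci (leq_trans (sorted_geq_nth sa (leq0n _)) aB).
apply: (iffP (rstabP _ _ _)) => -[H1 H2 H3 H4]; split.
- move=> i c nL; case: (boolP ((i < size a) && (c < B))%N) => [|/entry_out -> //].
  case/andP=> ia cB; rewrite (entryE S (Ordinal ia) (Ordinal cB)) H2 //.
  by rewrite /= leqNgt.
- by move=> i c L; have [ia cB] := inL _ _ L; rewrite (entryE S (Ordinal ia) (Ordinal cB)) H1.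
- move=> i c d cd L; have [ia dB] := inL _ _ L; have cB := ltn_trans cd dB.
  by rewrite (entryE S (Ordinal ia) (Ordinal cB)) (entryE S (Ordinal ia) (Ordinal dB)) H3.
- move=> i j c ij L; have [ja cB] := inL _ _ L; have ia := ltn_trans ij ja.
  by rewrite (entryE S (Ordinal ia) (Ordinal cB)) (entryE S (Ordinal ja) (Ordinal cB)) H4.
- by move=> i c L; rewrite -entryE H2.
- by move=> i c L; rewrite -entryE H1 // /inshape -leqNgt.
- by move=> i c d cd L; rewrite -!entryE H3.
- by move=> i j c ij L; rewrite -!entryE H4.
Qed.

Lemma nth_le_sumn (a : seq nat) i : (nth 0 a i <= sumn a)%N.
Proof.
elim: a i => [|x a IH] [|i] //=; first exact: leq_addr.
exact: leq_trans (IH i) (leq_addl _ _).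
Qed.

Lemma size_le_sumn (a : seq nat) : all (fun p => 0 < p)%N a -> (size a <= sumn a)%N.
Proof. by elim: a => //= x a IH /andP [x0 /IH]; lia. Qed.

Lemma incellE a i c : incell a (i, c) = inshape a i c.
Proof.
rewrite /incell /inshape /=; case: ltnP => //= le.
by rewrite nth_default.
Qed.

Lemma inshape_bound a i c : all (fun p => 0 < p)%N a -> inshape a i c ->
  (i < sumn a)%N /\ (c < sumn a)%N.
Proof.
move=> a0 L; split; last exact: leq_trans L (nth_le_sumn a i).
move: L; rewrite -incellE => /andP [/= ia _].
exact: leq_trans ia (size_le_sumn a0).
Qed.

(** The parts exceeding c form a prefix of a weakly decreasing list. This is the symmetry behind
    transposing a Ferrers diagram. *)
Lemma count_gt_sorted a c i : sorted geq a ->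
  (i < count (fun p => c < p)%N a)%N = (c < nth 0 a i)%N.
Proof.
elim: a i => [|x a IH] i /=; first by rewrite nth_nil !ltn0.
move=> pa; have sa := path_sorted pa.
case: (ltnP c x) => cx; first by case: i => [|i] //=; rewrite add1n ltnS IH.
have/allP ax := order_path_min geq_trans pa.
have -> : count (fun p => c < p)%N a = 0%N.
  apply/eqP; rewrite -leqn0 leqNgt -has_count; apply/hasPn => y /ax /= yx.
  by rewrite -leqNgt (leq_trans yx).
rewrite ltn0; symmetry; apply/negbTE; rewrite -leqNgt.
apply: leq_trans cx; case: i => [|i] //=.
by case: (ltnP i (size a)) => [lt|le]; [apply: ax (mem_nth _ lt)|rewrite nth_default].
Qed.

Lemma leq_foldr_maxn (a : seq nat) x : x \in a -> (x <= foldr maxn 0 a)%N.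
Proof. by elim: a => //= y a IH; rewrite inE => /orP [/eqP ->|/IH]; lia. Qed.

Lemma inshape_conjugate a c i : sorted geq a -> inshape (conjugate a) c i = inshape a i c.
Proof.
move=> sa; rewrite -incellE /incell size_mkseq /=.
case: (ltnP c _) => /= [lt|le]; first by rewrite nth_mkseq // count_gt_sorted.
rewrite /inshape; symmetry; apply/negbTE; rewrite -leqNgt; apply: leq_trans le.
case: (ltnP i (size a)) => [/(mem_nth 0%N)|le]; first exact: leq_foldr_maxn.
by rewrite nth_default.
Qed.

Lemma conjugate_gt0 a : all (fun p => 0 < p)%N (conjugate a).
Proof.
apply/allP => p /mapP [c]; rewrite mem_iota /= => lt ->.
rewrite -has_count; elim: a lt => //= x a IH; rewrite add0n leq_max.
by case/orP=> [-> //|lt]; rewrite IH // orbT.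
Qed.

(** Swapping coordinates turns strict columns into strict rows and weak rows into weak columns. *)
Lemma isSSYT_rs_fun (a : seq nat) m
    (T : {ffun grid (sumn (conjugate a)) -> 'I_m.+1}) : sorted geq a ->
  reflect (rs_fun (inshape a) m (fun i c => entry T c i)) (isSSYT (conjugate a) m T).
Proof.
move=> sa; set K := sumn _ in T *.
have LE c i : incell (conjugate a) (c, i) = inshape a i c.
  by rewrite incellE inshape_conjugate.
have inL i c : inshape a i c -> (c < K)%N /\ (i < K)%N.
  by rewrite -inshape_conjugate //; apply/inshape_bound/conjugate_gt0.
rewrite /isSSYT; apply: (iffP and4P) => [[/forallP H1 /forallP H2 /forallP H3 /forallP H4]|].
  split.
  - move=> i c nL; case: (boolP ((c < K) && (i < K))%N) => [|/entry_out -> //].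
    case/andP=> cK iK; rewrite (entryE T (Ordinal cK) (Ordinal iK)).
    by have := H1 (Ordinal cK, Ordinal iK); rewrite LE nL => /eqP.
  - move=> i c L; rewrite entry_le andbT; have [cK iK] := inL _ _ L.
    rewrite (entryE T (Ordinal cK) (Ordinal iK)).
    by have := H2 (Ordinal cK, Ordinal iK); rewrite LE L.
  - move=> i c d cd L; have [dK iK] := inL _ _ L; have cK := ltn_trans cd dK.
    have := forallP (H4 (Ordinal cK, Ordinal iK)) (Ordinal dK, Ordinal iK).
    rewrite (entryE T (Ordinal cK) (Ordinal iK)) (entryE T (Ordinal dK) (Ordinal iK)).
    by rewrite !LE L (inshape_left (ltnW cd) L) /= eqxx cd.
  - move=> i j c ij L; have [cK jK] := inL _ _ L; have iK := ltn_trans ij jK.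
    have := forallP (H3 (Ordinal cK, Ordinal iK)) (Ordinal cK, Ordinal jK).
    rewrite (entryE T (Ordinal cK) (Ordinal iK)) (entryE T (Ordinal cK) (Ordinal jK)).
    by rewrite !LE L (inshape_up sa (ltnW ij) L) /= eqxx ij.
move=> [H1 H2 H3 H4]; split.
- by apply/forallP => -[c i]; rewrite LE /= -entryE; apply/implyP => /H1/eqP.
- by apply/forallP => -[c i]; rewrite LE /= -entryE; apply/implyP => /H2/andP [].
- apply/forallP => -[c i]; apply/forallP => -[d j]; rewrite !LE /= -!entryE.
  by apply/implyP => /and4P [_ L /eqP -> ij]; apply: H4.
- apply/forallP => -[c i]; apply/forallP => -[d j]; rewrite !LE /= -!entryE.
  by apply/implyP => /and4P [_ L /eqP -> ij]; apply: H3.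
Qed.

Theorem schur_conjugate_rstab (a : seq nat) B M : sorted geq a -> (nth 0 a 0 <= B)%N ->
  schur (conjugate a) M (fun k => 'X^(k.-1)) =
  rstab_sum B M M (fun i : 'I_(size a) => nth 0%N a i).
Proof.
move=> sa aB; rewrite /schur /rstab_sum; set K := sumn _.
have inLK i c : inshape a i c -> (c < K)%N /\ (i < K)%N.
  by rewrite -inshape_conjugate //; apply/inshape_bound/conjugate_gt0.
have inL i c : inshape a i c -> (i < size a)%N /\ (c < B)%N.
  rewrite -incellE => /andP [/= ia ca]; split=> //.
  by apply: leq_trans ca (leq_trans (sorted_geq_nth sa (leq0n _)) aB).
pose toS (T : {ffun grid K -> 'I_M.+1}) := filling (size a) B M (fun i c => entry T c i).
pose toT (S : {ffun 'I_(size a) * 'I_B -> 'I_M.+1}) : {ffun grid K -> 'I_M.+1} :=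
  filling K K M (fun c i => entry S i c).
have entry_toS T : rs_fun (inshape a) M (fun i c => entry T c i) ->
    forall i c, entry (toS T) i c = entry T c i.
  case=> H1 _ _ _ i c; case: (boolP ((i < size a) && (c < B))%N) => [|nL].
    by case/andP=> ia cB; rewrite entry_filling ?entry_le.
  rewrite entry_out // H1 //; apply: contra nL => /inL [-> ->] //.
have entry_toT S : rs_fun (inshape a) M (entry S) -> forall i c, entry (toT S) c i = entry S i c.
  case=> H1 _ _ _ i c; case: (boolP ((c < K) && (i < K))%N) => [|nL].
    by case/andP=> ia cB; rewrite entry_filling ?entry_le.
  rewrite entry_out // H1 //; apply: contra nL => /inLK [-> ->] //.
rewrite (reindex_onto toT toS) /= => [|T /(isSSYT_rs_fun _ sa) tT]; last first.
  by apply: filling_entry => c i _ _; rewrite entry_toS.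
have tE S : isSSYT (conjugate a) M (toT S) && (toS (toT S) == S)
    = rstab M (fun i : 'I_(size a) => nth 0%N a i) S.
  apply/andP/(rstab_rs_fun _ _ sa aB) => [[/(isSSYT_rs_fun _ sa) tT /eqP <-]|tS].
    by apply: (eq_rs_fun _ tT) => i c; rewrite entry_toS.
  have E := entry_toT _ tS; split.
    by apply/(isSSYT_rs_fun _ sa); apply: eq_rs_fun tS => i c; rewrite E.
  by apply/eqP/filling_entry => i c _ _; rewrite E.
apply: eq_big => [S|S]; first exact: tE.
rewrite tE => /(rstab_rs_fun _ _ sa aB) tS; have E := entry_toT _ tS.
have [H0 _ _ _] := tS.
(* Both exponents become double sums of [(entry S i c).-1]; the two grids contain the shape, and the
   summand vanishes outside it. *)
rewrite -expr_sum; congr ('X^_).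
rewrite (eq_bigr (fun c : grid K => (entry (toT S) c.1 c.2).-1)) => [|[i c] _];
  last by rewrite entryE.
rewrite big_mkcond (eq_bigr (fun c : grid K => (entry S c.2 c.1).-1)) => [|[c i] _] /=; last first.
  by rewrite incellE inshape_conjugate //; case: ifP => [_|/negbT/H0 ->]; rewrite ?E.
rewrite -(pair_bigA _ (fun c i : 'I_K => (entry S i c).-1)) exchange_big /=.
rewrite [RHS](eq_bigr (fun c : 'I_(size a) * 'I_B => (entry S c.1 c.2).-1)) => [|[i c] _];
  last by rewrite entryE.
rewrite -(pair_bigA _ (fun (i : 'I_(size a)) (c : 'I_B) => (entry S i c).-1)) /=.
pose G N i := (\sum_(c < N) (entry S i c).-1)%N.
have G0 N j : (forall c, ~~ inshape a j c) -> G N j = 0%N.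
  by move=> nL; rewrite /G big1 // => c _; rewrite H0.
apply: (@sum_ord_eqn _ _ (G K) (G B)) => i.
- rewrite /G; pose g c := (entry S i c).-1; apply: (@sum_ord_eqn K B g g) => // c le; rewrite /g.
  + by rewrite H0 //; apply/negP => /inLK []; lia.
  + by rewrite H0 //; apply/negP => /inL []; lia.
- by move=> le; apply: G0 => c; apply/negP => /inLK []; lia.
- by move=> le; apply: G0 => c; apply/negP => /inL []; lia.
Qed.

(** * Ranks in finite sets *)

Definition rank (C : finType) (P : pred C) (key : C -> nat) (k : nat) : nat :=
  #|[pred d | P d && (key d <= k)%N]|.

Lemma rank_leq (C : finType) (P : pred C) (key : C -> nat) c k : P c ->
  (rank P key (key c) <= rank P key k)%N = (key c <= k)%N.
Proof.
move=> Pc; apply/idP/idP => [|le]; last first.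
  by apply/subset_leq_card/subsetP => e; rewrite !inE => /andP [-> /leq_trans]; apply.
apply: contraTT; rewrite -!ltnNge => lt; apply/proper_card/properP; split.
  by apply/subsetP => e; rewrite !inE => /andP [-> le]; rewrite ltnW // (leq_ltn_trans le).
by exists c; rewrite !inE Pc ?leqnn //= -ltnNge.
Qed.

Lemma perm_values (C : finType) (P : pred C) (T : C -> nat) :
  {in P &, injective T} -> (forall c, P c -> 0 < T c <= #|P|)%N ->
  perm_eq [seq T c | c <- enum P] (iota 1 #|P|).
Proof.
move=> injT bT.
have uT : uniq [seq T c | c <- enum P].
  rewrite map_inj_in_uniq ?enum_uniq // => c d; rewrite !mem_enum; exact: injT.
apply: uniq_perm (iota_uniq _ _) _ => //.
have sub : {subset [seq T c | c <- enum P] <= iota 1 #|P|}.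
  by move=> v /mapP [c]; rewrite mem_enum => /bT b ->; rewrite mem_iota add1n ltnS.
by apply: (uniq_min_size uT sub _).2; rewrite size_iota size_map -cardE.
Qed.

(** The values are exactly 1, ..., N, so k of them are at most k. *)
Lemma rank_values (C : finType) (P : pred C) (T : C -> nat) c :
  {in P &, injective T} -> (forall c, P c -> 0 < T c <= #|P|)%N -> P c ->
  rank P T (T c) = T c.
Proof.
move=> injT bT Pc; have pT := perm_values injT bT.
have cnt k m : (k <= m)%N -> count (fun v => v <= k)%N (iota 1 m) = k.
  move=> km; rewrite -(subnKC km) iotaD count_cat.
  rewrite (_ : count _ (iota 1 k) = k); last first.
    rewrite (eq_in_count (a2 := predT)) ?count_predT ?size_iota // => v.
    by rewrite mem_iota /=; lia.
  rewrite (_ : count _ (iota _ _) = 0%N) ?addn0 //.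
  rewrite (eq_in_count (a2 := pred0)) ?count_pred0 // => v.
  by rewrite mem_iota /=; lia.
have /andP [_ le] := bT c Pc; rewrite -[RHS](cnt _ _ le) -(seq.permP pT) count_map.
rewrite /rank cardE -size_filter /enum_mem -filter_predI size_filter.
by rewrite size_filter; apply: eq_count => d; rewrite !inE /= andbC.
Qed.

(** Distinct keys have ranks 1, ..., N in some order; their sum is the exponent of the q-power in
    the theorem. *)
Lemma sum_rank (C : finType) (P : pred C) (key : C -> nat) :
  {in P &, injective key} ->
  (\sum_(c | P c) rank P key (key c) = 'C(#|P|.+1, 2))%N.
Proof.
move=> injK.
have injR : {in P &, injective (fun c => rank P key (key c))}.
  move=> c d Pc Pd E; apply: injK => //; apply/eqP; rewrite eqn_leq.
  by rewrite -(rank_leq _ _ Pc) -(rank_leq _ _ Pd) E leqnn.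
have bR c : P c -> (0 < rank P key (key c) <= #|P|)%N.
  move=> Pc; apply/andP; split; last by apply/subset_leq_card/subsetP => d /andP [].
  by apply/card_gt0P; exists c; rewrite inE Pc /=.
have := perm_big _ (perm_values injR bR) => /(_ nat addn 0%N xpredT id) /=.
rewrite big_map big_enum_cond /= (eq_bigl P) => [->|c]; last by rewrite andbT.
by rewrite -bin2_sum big_nat_recl //= add0n /index_iota subn0 (iotaDl 1 0) big_map.
Qed.

(** * Standard tableaux with the maximal number of descents *)

Definition cells (lam : seq nat) : pred (grid (sumn lam)) :=
  fun c => inshape lam c.1 c.2.
Arguments cells : clear implicits.

Lemma sum_cells (lam : seq nat) (G : nat -> nat -> nat) :
  all (fun p => 0 < p)%N lam ->
  (\sum_(c | cells lam c) G c.1 c.2 =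
   \sum_(i < size lam) \sum_(j < nth 0 lam i) G i j)%N.
Proof.
move=> lam0; rewrite big_mkcond /=.
rewrite -(pair_bigA _ (fun i j : 'I_(sumn lam) => if inshape lam i j then G i j else 0%N)) /=.
pose H i := (\sum_(j < nth 0 lam i) G i j)%N.
rewrite (eq_bigr (fun i : 'I_(sumn lam) => H i)) => [|i _]; last first.
  by rewrite /H (big_ord_widen _ (G i) (nth_le_sumn lam i)) [RHS]big_mkcond.
apply: (@sum_ord_eqn _ _ H H) => // i le; rewrite /H nth_default ?big_ord0 //.
exact: leq_trans (size_le_sumn lam0) le.
Qed.

Lemma card_cells (lam : seq nat) : all (fun p => 0 < p)%N lam ->
  #|cells lam| = sumn lam.
Proof.
move=> lam0; rewrite -sum1_card (sum_cells (fun _ _ => 1%N) lam0) sumnE (big_nth 0%N) big_mkord.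
by apply: eq_bigr => i _; rewrite sum1_card card_ord.
Qed.

Lemma card_cells0 (lam : seq nat) : all (fun p => 0 < p)%N lam ->
  #|[pred c | cells lam c && (0 < c.1)%N]| = (sumn lam - head 0 lam)%N.
Proof.
move=> lam0; rewrite -sum1_card (eq_bigl (fun c => cells lam c && (0 < c.1)%N)) //.
rewrite big_mkcondr (sum_cells (fun i _ => if (0 < i)%N then 1%N else 0%N) lam0).
case: lam lam0 => [|l a] lam0; first by rewrite big_ord0.
rewrite big_ord_recl /= big1 // add0n addKn sumnE (big_nth 0%N) big_mkord.
by apply: eq_bigr => i _; rewrite sum1_card card_ord.
Qed.

Definition syt_fun (lam : seq nat) (g : nat -> nat -> nat) : Prop :=
  [/\ forall i c, ~~ inshape lam i c -> g i c = 0%N,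
      forall i c, inshape lam i c -> (0 < g i c <= sumn lam)%N,
      forall i c j d, inshape lam i c -> inshape lam j d -> g i c = g j d -> i = j /\ c = d,
      forall i c d, (c < d)%N -> inshape lam i d -> (g i c < g i d)%N
    & forall i j c, (i < j)%N -> inshape lam j c -> (g i c < g j c)%N].

Lemma eq_syt_fun lam g h : (forall i j, g i j = h i j) -> syt_fun lam g -> syt_fun lam h.
Proof.
move=> gh [H1 H2 H3 H4 H5]; split=> [i c|i c|i c j d|i c d|i j c]; rewrite -!gh; auto.
Qed.

Lemma syt_perm_values lam g : all (fun p => 0 < p)%N lam -> syt_fun lam g ->
  perm_eq [seq g c.1 c.2 | c : grid (sumn lam) <- enum (cells lam)] (iota 1 (sumn lam)).
Proof.
move=> lam0 [_ H2 H3 _ _]; rewrite -[X in iota _ X](card_cells lam0); apply: perm_values.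
  move=> [i c] [j d] Lc Ld /= E; have [] := H3 _ _ _ _ Lc Ld E.
  by move=> /= /val_inj -> /val_inj ->.
by move=> [i c] L; rewrite card_cells //; apply: H2.
Qed.

(** Injectivity, with as many cells as admissible values, forces every value to occur. *)
Lemma syt_surj lam g v : all (fun p => 0 < p)%N lam -> syt_fun lam g ->
  (0 < v <= sumn lam)%N -> exists i c, inshape lam i c /\ g i c = v.
Proof.
move=> lam0 gP vb; have := perm_mem (syt_perm_values lam0 gP) v.
rewrite mem_iota add1n ltnS vb => /mapP [[i c]]; rewrite mem_enum => L ->.
by exists i, c.
Qed.

Lemma isSYT_syt_fun lam (T : {ffun grid (sumn lam) -> 'I_(sumn lam).+1}) :
  sorted geq lam -> all (fun p => 0 < p)%N lam ->
  reflect (syt_fun lam (entry T)) (isSYT lam T).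
Proof.
move=> sl lam0; set K := sumn _ in T *.
have inL i c : inshape lam i c -> (i < K)%N /\ (c < K)%N by apply: inshape_bound.
rewrite /isSYT; apply: (iffP and5P) => [[/forallP H1 /forallP H2 /forallP H3 H4]|].
  case/andP=> /forallP H5 /forallP H6; split.
  - move=> i c nL; case: (boolP ((i < K) && (c < K))%N) => [|/entry_out -> //].
    case/andP=> iK cK; rewrite (entryE T (Ordinal iK) (Ordinal cK)).
    by have := H1 (Ordinal iK, Ordinal cK); rewrite incellE nL => /eqP.
  - move=> i c L; rewrite entry_le andbT; have [iK cK] := inL _ _ L.
    rewrite (entryE T (Ordinal iK) (Ordinal cK)).
    by have := H2 (Ordinal iK, Ordinal cK); rewrite incellE L.
  - move=> i c j d L L'; have [iK cK] := inL _ _ L; have [jK dK] := inL _ _ L'.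
    rewrite (entryE T (Ordinal iK) (Ordinal cK)) (entryE T (Ordinal jK) (Ordinal dK)).
    move/val_inj => E.
    have := forallP (H3 (Ordinal iK, Ordinal cK)) (Ordinal jK, Ordinal dK).
    by rewrite !incellE L L' E eqxx /= => /eqP [-> ->].
  - move=> i c d cd L; have [iK dK] := inL _ _ L; have cK := ltn_trans cd dK.
    have := forallP (H5 (Ordinal iK, Ordinal cK)) (Ordinal iK, Ordinal dK).
    rewrite (entryE T (Ordinal iK) (Ordinal cK)) (entryE T (Ordinal iK) (Ordinal dK)).
    by rewrite !incellE L (inshape_left (ltnW cd) L) /= eqxx cd.
  - move=> i j c ij L; have [jK cK] := inL _ _ L; have iK := ltn_trans ij jK.
    have := forallP (H6 (Ordinal iK, Ordinal cK)) (Ordinal jK, Ordinal cK).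
    rewrite (entryE T (Ordinal iK) (Ordinal cK)) (entryE T (Ordinal jK) (Ordinal cK)).
    by rewrite !incellE L (inshape_up sl (ltnW ij) L) /= eqxx ij.
move=> gP; have [H1 H2 H3 H4 H5] := gP; split.
- by apply/forallP => -[i c]; rewrite incellE /= -entryE; apply/implyP => /H1/eqP.
- by apply/forallP => -[i c]; rewrite incellE /= -entryE; apply/implyP => /H2/andP [].
- apply/forallP => -[i c]; apply/forallP => -[j d]; rewrite !incellE /=.
  apply/implyP => /and3P [L L' /eqP E].
  have [] := H3 _ _ _ _ L L'; first by rewrite !entryE E.
  by move=> /val_inj -> /val_inj ->.
- apply/forallP => v; apply/implyP => v0.
  have [|i [c [L E]]] := syt_surj (v := v) lam0 gP; first by rewrite v0 -ltnS /=.
  have [iK cK] := inL _ _ L; apply/existsP; exists (Ordinal iK, Ordinal cK).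
  by rewrite incellE L /=; apply/eqP/val_inj; rewrite /= -entryE.
- apply/andP; split; apply/forallP => -[i c]; apply/forallP => -[j d].
    rewrite !incellE /= -!entryE.
    by apply/implyP => /and4P [_ L /eqP -> lt]; apply: H4.
  rewrite !incellE /= -!entryE.
  by apply/implyP => /and4P [_ L /eqP -> lt]; apply: H5.
Qed.

Lemma rowofE lam (T : {ffun grid (sumn lam) -> 'I_(sumn lam).+1}) i c :
  all (fun p => 0 < p)%N lam -> syt_fun lam (entry T) -> inshape lam i c ->
  rowof T (entry T i c) = i.
Proof.
move=> lam0 [H1 H2 H3 _ _] L; rewrite /rowof; case: pickP => [[j d] /eqP /= E|no].
  move: E; rewrite -entryE => E.
  have [|nL] := boolP (inshape lam j d); first by move=> L'; case: (H3 _ _ _ _ L' L E).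
  by have := H2 _ _ L; rewrite -E H1.
have [iK cK] := inshape_bound lam0 L.
by have := no (Ordinal iK, Ordinal cK); rewrite /= -entryE eqxx.
Qed.

Definition maxdes lam (g : nat -> nat -> nat) : Prop :=
  forall i c j d, inshape lam i c -> inshape lam j d ->
    g j d = (g i c).+1 -> (0 < j)%N -> (i < j)%N.

(* Every descent m has m+1 outside the first row; the descents number n - lam_1
   exactly when each entry outside the first row arises in this way. *)
Lemma desE lam (T : {ffun grid (sumn lam) -> 'I_(sumn lam).+1}) :
  sorted geq lam -> all (fun p => 0 < p)%N lam -> syt_fun lam (entry T) ->
  (des (sumn lam) T == (sumn lam - head 0 lam)%N <-> maxdes lam (entry T))
  /\ (maxdes lam (entry T) ->
      maj (sumn lam) T = \sum_(c | cells lam c && (0 < c.1)%N) (entry T c.1 c.2).-1)%N.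
Proof.
move=> sl lam0 gP; set n := sumn lam in T gP *.
have [H1 H2 H3 H4 H5] := gP.
pose q m := (0 < rowof T m.+1)%N; pose p m := (rowof T m < rowof T m.+1)%N.
have sumq (G : nat -> nat) : (\sum_(m <- iota 1 n.-1 | q m) G m =
    \sum_(c | cells lam c && (0 < c.1)%N) G (entry T c.1 c.2).-1)%N.
  (* Shift from m to v = m+1. The added value v = 1 contributes nothing, since 1 lies in the first
     row. *)
  transitivity (\sum_(v <- iota 1 n | (0 < rowof T v)%N) G v.-1)%N; last first.
    rewrite -(perm_big _ (syt_perm_values lam0 gP)) /= big_map big_enum_cond /=.
    by apply: eq_bigl => -[i c]; apply: andb_id2l => L; rewrite /= (rowofE lam0 gP L).
  have [n0|n0] := posnP n.
    have -> : iota 1 n = [::] by rewrite n0.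
    by have -> : iota 1 n.-1 = [::]; rewrite ?n0 // !big_nil.
  have -> : iota 1 n = 1%N :: iota 2 n.-1 by rewrite -[in LHS](prednK n0).
  rewrite big_cons ifN; last first.
    have [//|i [c [L E]]] := syt_surj (v := 1) lam0 gP.
    have := rowofE lam0 gP L; rewrite E => ->; rewrite -eqn0Ngt; apply/eqP.
    case: i L E => // i L E; have := H5 0%N i.+1 c isT L.
    have L0 := inshape_up sl (leq0n i.+1) L.
    by have := H2 _ _ L0; rewrite E; lia.
  by rewrite (iotaDl 1 1) big_map.
have szq : size (filter q (iota 1 n.-1)) = (n - head 0 lam)%N.
  by rewrite size_filter -sum1_count sumq -(card_cells0 lam0) -sum1_card.
have pq : filter p (iota 1 n.-1) = filter p (filter q (iota 1 n.-1)).
  rewrite -filter_predI; apply: eq_filter => m /=; rewrite /p /q.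
  by case: ltnP => //= /(leq_ltn_trans (leq0n _)) ->.
(* The descents form a subsequence of the m with m+1 below the first row, and there are n - lam_1 of
   those; equal sizes mean equal lists. *)
have desA : (des n T == (n - head 0 lam)%N) = all p (filter q (iota 1 n.-1)).
  rewrite /des /descents -szq -/(p) pq.
  rewrite (size_subseq_leqif (filter_subseq p _)).
  by apply/eqP/all_filterP.
have maxP : all p (filter q (iota 1 n.-1)) <-> maxdes lam (entry T).
  split=> [/allP H i c j d L L' E j0|H].
    have := H (entry T i c); rewrite mem_filter /p /q -E !(rowofE lam0 gP) // j0 mem_iota.
    apply; have := H2 _ _ L; have := H2 _ _ L'; rewrite E -/n; lia.
  apply/allP => m; rewrite mem_filter mem_iota => /andP [qm mb].
  have [|i [c [L E]]] := syt_surj (v := m) lam0 gP; first by rewrite -/n; lia.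
  have [|j [d [L' E']]] := syt_surj (v := m.+1) lam0 gP; first by rewrite -/n; lia.
  move: qm; rewrite /p /q -E' -E !(rowofE lam0 gP) //.
  by apply: H L L' _; rewrite E E'.
split; first by rewrite desA.
move=> /maxP/all_filterP pqE; rewrite /maj /descents -/p pq pqE.
by rewrite sumnE big_filter sumq.
Qed.

(** * Segments cut out by the first row *)

(** The index of the segment containing v: segment s begins at the s-th entry of the first row. *)
Definition seg (l : nat) (g : nat -> nat -> nat) (v : nat) : nat :=
  #|[pred j : 'I_l | (g 0 j <= v)%N]|.

Lemma seg_mono l g v w : (v <= w)%N -> (seg l g v <= seg l g w)%N.
Proof.
move=> vw; apply/subset_leq_card/subsetP => j; rewrite !inE => /leq_trans; exact.
Qed.

Lemma card_ord_ltn l k : (k <= l)%N -> #|[pred j : 'I_l | (j < k)%N]| = k.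
Proof.
move=> kl; rewrite -sum1_card (eq_bigl (fun j : 'I_l => (j < k)%N)) //.
by rewrite -(big_ord_widen l (fun=> 1%N) kl) sum1_card card_ord.
Qed.

Lemma seg_row0 l a g c : syt_fun (l :: a) g -> (c < l)%N -> seg l g (g 0%N c) = c.+1.
Proof.
move=> [_ _ _ H4 _] cl; rewrite -[RHS](card_ord_ltn cl); apply: eq_card => j; rewrite !inE ltnS.
apply/idP/idP => [|]; last first.
  by rewrite leq_eqVlt => /orP [/eqP -> //|jc]; apply: ltnW; apply: H4.
apply: contraTT; rewrite -!ltnNge => cj; exact: (H4 0%N _ _ cj (ltn_ord j)).
Qed.

(** Going down from the larger entry by predecessors, no first-row entry is met before the smaller
    one is reached, so by [maxdes] every step moves to a strictly higher row. *)
Lemma seg_chain l a g i c j d : all (fun p => 0 < p)%N (l :: a) ->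
  syt_fun (l :: a) g -> maxdes (l :: a) g ->
  inshape (l :: a) i c -> inshape (l :: a) j d ->
  (g i c < g j d)%N -> seg l g (g i c) = seg l g (g j d) -> (i < j)%N.
Proof.
move=> lam0 gP mg L; have [_ H2 H3 _ _] := gP.
have [k] := ubnP (g j d); elim: k j d => // k IH j d kd L' lt sE.
have j0 : (0 < j)%N.
  (* A larger entry in the first row would open a new segment. *)
  case: j L' lt sE {kd} => // L' lt sE; exfalso.
  suff : (seg l g (g i c) < seg l g (g 0 d))%N by rewrite sE ltnn.
  apply/proper_card/properP; split.
    by apply/subsetP => e; rewrite !inE => le; apply: leq_trans le (ltnW lt).
  have dl : (d < l)%N by [].
  by exists (Ordinal dl); rewrite !inE //= -ltnNge.
have vb : (0 < (g j d).-1 <= sumn (l :: a))%N.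
  by have := H2 _ _ L'; have := H2 _ _ L; lia.
have [i' [c' [L'' E]]] := syt_surj lam0 gP vb.
have ij : (i' < j)%N by apply: (mg i' c' j d) => //; rewrite E; lia.
have le : (g i c <= g i' c')%N by rewrite E; lia.
move: le; rewrite leq_eqVlt => /orP [/eqP/(H3 _ _ _ _ L L'') [-> _] //|lt'].
apply: ltn_trans ij; apply: (IH i' c') => //; first by rewrite E; lia.
apply/eqP; rewrite eqn_leq (seg_mono _ _ (ltnW lt')) sE seg_mono //.
by rewrite E; lia.
Qed.

Definition segtab l a g (i c : nat) : nat :=
  if inshape a i c then seg l g (g i.+1 c) else 0%N.

(** Two cells of one row in the same segment would contradict [seg_chain]; columns are weak because
    [seg] is monotone. Entries are positive because the first-row cell of the same column has a
    smaller entry. *)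
Lemma segtab_rs_fun l a g : sorted geq (l :: a) -> all (fun p => 0 < p)%N (l :: a) ->
  syt_fun (l :: a) g -> maxdes (l :: a) g -> rs_fun (inshape a) l (segtab l a g).
Proof.
move=> sl lam0 gP mg; have [H1 H2 H3 H4 H5] := gP.
have sa : sorted geq a by apply: path_sorted sl.
rewrite /segtab; split=> [i c /negbTE -> //|i c L|i c d cd L|i j c ij L].
- have L' : inshape (l :: a) i.+1 c by [].
  have cl : (c < l)%N := inshape_up sl (leq0n i.+1) L'.
  rewrite L; apply/andP; split; last by rewrite -[X in (_ <= X)%N](card_ord l) max_card.
  apply/card_gt0P; exists (Ordinal cl).
  by rewrite inE /= ltnW // H5.
- rewrite L (inshape_left (ltnW cd) L).
  have Ld : inshape (l :: a) i.+1 d by [].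
  have Lc := inshape_left (ltnW cd) Ld.
  have lt := H4 _ _ _ cd Ld.
  rewrite ltn_neqAle seg_mono ?andbT; last exact: ltnW.
  by apply/eqP => E; have := seg_chain lam0 gP mg Lc Ld lt E; rewrite ltnn.
- rewrite L (inshape_up sa (ltnW ij) L); apply: seg_mono.
  by apply/ltnW/H5.
Qed.

(** * Standardization of row-strict fillings *)

Definition ext (h : nat -> nat -> nat) (i c : nat) : nat :=
  if i is i'.+1 then h i' c else c.+1.

Lemma ext_segtab l a g i c : syt_fun (l :: a) g -> inshape (l :: a) i c ->
  ext (segtab l a g) i c = seg l g (g i c).
Proof.
move=> gP; case: i => [|i] L /=; first by rewrite (seg_row0 gP).
by rewrite /segtab ifT.
Qed.

Lemma ext_rs_fun l a h : sorted geq (l :: a) ->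
  rs_fun (inshape a) l h ->
  [/\ forall i c, inshape (l :: a) i c -> (0 < ext h i c <= l)%N,
      forall i c d, (c < d)%N -> inshape (l :: a) i d -> (ext h i c < ext h i d)%N
    & forall i j c, (i < j)%N -> inshape (l :: a) j c -> (ext h i c <= ext h j c)%N].
Proof.
move=> sl [H1 H2 H3 H4]; split.
- by move=> [|i] c L //=; apply: H2.
- by move=> [|i] c d cd L //=; apply: H3.
move=> [|i] [|j] c //= ij L; last exact: H4.
(* Against the first row, strictness of the lower row gives an entry of at least c+1 in column c. *)
elim: c L => [|c IH] L; first by case/andP: (H2 _ _ L).
have L' : inshape a j c := inshape_left (leqnSn c) L.
exact: leq_ltn_trans (IH L') (H3 _ _ _ (ltnSn c) L).
Qed.

(* Since rows are indexed below k, keys compare lexicographically by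
   (entry of the tableau extended by the first row 1, 2, ..., l; row). *)
Definition key k h (i c : nat) : nat := (ext h i c * k + i)%N.

Lemma leq_lex k s t i j : (i < k)%N -> (j < k)%N ->
  (s * k + i <= t * k + j)%N = (s < t)%N || ((s == t) && (i <= j)%N).
Proof.
move=> ik jk; have [st|ts|->] /= := ltngtP s t; last by rewrite leq_add2l.
  have := leq_mul2r k s.+1 t; rewrite st orbT mulSn; lia.
have := leq_mul2r k t.+1 s; rewrite ts orbT mulSn; lia.
Qed.

Lemma inshape_row lam i c : inshape lam i c -> (i < size lam)%N.
Proof. by rewrite -incellE => /andP []. Qed.

Lemma leq_key lam h i c j d : inshape lam i c -> inshape lam j d ->
  (key (size lam) h i c <= key (size lam) h j d)%N =
  (ext h i c < ext h j d)%N || ((ext h i c == ext h j d) && (i <= j)%N).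
Proof. by move=> /inshape_row ik /inshape_row jk; rewrite leq_lex. Qed.

(** Equal keys mean equal rows and equal entries, and a strict row holds each entry once. *)
Lemma key_inj l a h i c j d : sorted geq (l :: a) -> rs_fun (inshape a) l h ->
  inshape (l :: a) i c -> inshape (l :: a) j d ->
  key (size (l :: a)) h i c = key (size (l :: a)) h j d -> i = j /\ c = d.
Proof.
move=> sl hP L L' E; have [_ ER _] := ext_rs_fun sl hP.
have := leq_key h L L'; have := leq_key h L' L.
rewrite E leqnn => /esym X /esym Y.
have {X Y} [ij eE] : i = j /\ ext h i c = ext h j d.
  move: X Y; case: (ltngtP (ext h i c) (ext h j d)) => //= eE ji ij; split=> //.
  by apply/eqP; rewrite eqn_leq ij ji.
subst j; split=> //.
by case: (ltngtP c d) => // lt; [have := ER _ _ _ lt L' | have := ER _ _ _ lt L]; rewrite eE ltnn.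
Qed.

(** Equal entries are numbered from top to bottom, so that runs of them go strictly down. *)
Definition standard l a h (i c : nat) : nat :=
  if inshape (l :: a) i c then
    rank (cells (l :: a)) (fun d => key (size (l :: a)) h d.1 d.2)
      (key (size (l :: a)) h i c)
  else 0%N.

Lemma leq_standard l a h i c j d : all (fun p => 0 < p)%N (l :: a) ->
  inshape (l :: a) i c -> inshape (l :: a) j d ->
  (standard l a h i c <= standard l a h j d)%N =
  (key (size (l :: a)) h i c <= key (size (l :: a)) h j d)%N.
Proof.
move=> lam0 L L'; have [iK cK] := inshape_bound lam0 L.
rewrite /standard L L'.
exact: (@rank_leq _ (cells (l :: a)) (fun d => key (size (l :: a)) h d.1 d.2)
  (Ordinal iK, Ordinal cK)).
Qed.

Lemma standard_syt_fun l a h : sorted geq (l :: a) -> all (fun p => 0 < p)%N (l :: a) ->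
  rs_fun (inshape a) l h -> syt_fun (l :: a) (standard l a h).
Proof.
move=> sl lam0 hP; have [E1 E2 E3] := ext_rs_fun sl hP.
have ltT i c j d : inshape (l :: a) i c -> inshape (l :: a) j d ->
    (standard l a h i c < standard l a h j d)%N =
    (key (size (l :: a)) h i c < key (size (l :: a)) h j d)%N.
  by move=> L L'; rewrite !ltnNge leq_standard.
split=> [i c|i c L|i c j d L L'|i c d cd L|i j c ij L].
- by rewrite /standard => /negbTE ->.
- have [iK cK] := inshape_bound lam0 L.
  rewrite /standard L; apply/andP; split.
    by apply/card_gt0P; exists (Ordinal iK, Ordinal cK); rewrite !inE /cells /= L /=.
  rewrite -[X in (_ <= X)%N](card_cells lam0).
  by apply/subset_leq_card/subsetP => d /andP [].
- move=> E; apply: (key_inj sl hP L L'); apply/eqP.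
  by rewrite eqn_leq -!leq_standard // E leqnn.
- have Lc := inshape_left (ltnW cd) L.
  by rewrite ltT // ltnNge leq_key // negb_or -leqNgt (ltnW (E2 _ _ _ cd L)) /=
     gtn_eqF // E2.
- have Li := inshape_up sl (ltnW ij) L.
  by rewrite ltT // ltnNge leq_key // negb_or -leqNgt E3 //= negb_and -ltnNge ij orbT.
Qed.

(* Between a cell of segment < s and a non-first-row cell of segment s, the
   order of keys inserts the s-th cell of the first row. *)
Lemma standard_maxdes l a h : sorted geq (l :: a) -> all (fun p => 0 < p)%N (l :: a) ->
  rs_fun (inshape a) l h -> maxdes (l :: a) (standard l a h).
Proof.
move=> sl lam0 hP i c j d L L' E j0; have [E1 _ _] := ext_rs_fun sl hP.
have := leq_standard h lam0 L L'; rewrite E leqnSn leq_key // => /esym.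
have := leq_standard h lam0 L' L; rewrite E ltnn leq_key //.
case: (ltngtP (ext h i c) (ext h j d)) => //= [lt _ _|_]; last first.
  by move/esym/negbT; rewrite -ltnNge.
have sb := E1 _ _ L'; set s := ext h j d in lt sb.
(* The column is [s.-1] because [ext] fills the first row from 1 upward. The number of this cell
   would lie strictly between two consecutive integers. *)
have L0 : inshape (l :: a) 0 s.-1 by rewrite /inshape /=; lia.
have s0 : ext h 0 s.-1 = s by rewrite /=; lia.
exfalso.
have := leq_standard h lam0 L0 L; rewrite leq_key // s0 ltnNge (ltnW lt) gtn_eqF //=.
have := leq_standard h lam0 L' L0; rewrite leq_key // s0 -/s ltnn eqxx /= leqn0 eqn0Ngt j0 E.
by lia.
Qed.

(** A standard tableau is its own rank function, so entries and keys need only order the cells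
    alike: by segment first, then by row within a segment, through [seg_chain]. *)
Lemma segtabK l a g i c : sorted geq (l :: a) -> all (fun p => 0 < p)%N (l :: a) ->
  syt_fun (l :: a) g -> maxdes (l :: a) g -> standard l a (segtab l a g) i c = g i c.
Proof.
move=> sl lam0 gP mg; have [H1 H2 H3 H4 H5] := gP.
rewrite /standard; case: ifP => [L|/negbT/H1 -> //].
have [iK cK] := inshape_bound lam0 L.
pose T (c : grid (sumn (l :: a))) := g c.1 c.2.
have injT : {in cells (l :: a) &, injective T}.
  move=> [i1 c1] [i2 c2] L1 L2 /= E; have [] := H3 _ _ _ _ L1 L2 E.
  by move=> /= /val_inj -> /val_inj ->.
have bT d : cells (l :: a) d -> (0 < T d <= #|cells (l :: a)|)%N.
  by rewrite card_cells // => Ld; apply: H2.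
rewrite -[RHS]/(T (Ordinal iK, Ordinal cK)) -(rank_values injT bT); last exact: L.
apply: eq_card => -[j d]; rewrite !inE; apply: andb_id2l => L'.
rewrite [LHS](leq_key (segtab l a g) L' L) !(ext_segtab gP) // /T /=.
have lt2 i1 c1 i2 c2 : inshape (l :: a) i1 c1 -> inshape (l :: a) i2 c2 ->
    (g i1 c1 < g i2 c2)%N -> (seg l g (g i1 c1) < seg l g (g i2 c2))%N ||
       (seg l g (g i1 c1) == seg l g (g i2 c2)) && (i1 < i2)%N.
  move=> L1 L2 lt; have := seg_mono l g (ltnW lt); rewrite leq_eqVlt.
  case/orP=> [/eqP sE|-> //]; rewrite sE eqxx ltnn /=.
  exact: (seg_chain lam0 gP mg L1 L2).
have [lt|lt|/(H3 _ _ _ _ L' L) [-> ->]] := ltngtP (g j d) (g i c); last first.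
- by rewrite eqxx leqnn orbT.
- have := lt2 _ _ _ _ L L' lt; case: ltngtP => //= _ ij.
  by apply/negbTE; rewrite -ltnNge.
- by have := lt2 _ _ _ _ L' L lt; case: ltngtP => //= _ /ltnW.
Qed.

(** The first-row cells numbered below a lower cell of entry s are those of entry at most s, ties
    being won by row 0; there are s of them. *)
Lemma standardK l a h i c : sorted geq (l :: a) -> all (fun p => 0 < p)%N (l :: a) ->
  rs_fun (inshape a) l h -> segtab l a (standard l a h) i c = h i c.
Proof.
move=> sl lam0 hP; have [H1 H2 _ _] := hP.
rewrite /segtab; case: ifP => [L|/negbT/H1 -> //].
have /andP [_ le] := H2 _ _ L.
rewrite -[RHS](card_ord_ltn le); apply: eq_card => j; rewrite !inE.
have L0 : inshape (l :: a) 0 j by exact: ltn_ord.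
rewrite leq_standard // leq_key //= andbT.
by rewrite orbC -leq_eqVlt.
Qed.

(** * Weights and generating functions *)

Lemma segtab_weight l a g : sorted geq (l :: a) -> all (fun p => 0 < p)%N (l :: a) ->
  syt_fun (l :: a) g ->
  (\sum_(c | cells (l :: a) c && (0 < c.1)%N) (g c.1 c.2).-1 =
   'C((sumn a).+1, 2) + \sum_(i < size a) \sum_(c < l) (segtab l a g i c).-1)%N.
Proof.
move=> sl lam0 gP; have [H1 H2 H3 H4 H5] := gP.
pose P := [pred c | cells (l :: a) c && (0 < c.1)%N].
pose T (c : grid (sumn (l :: a))) := g c.1 c.2.
have injT : {in cells (l :: a) &, injective T}.
  move=> [i1 c1] [i2 c2] L1 L2 /= E; have [] := H3 _ _ _ _ L1 L2 E.
  by move=> /= /val_inj -> /val_inj ->.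
have bT d : cells (l :: a) d -> (0 < T d <= #|cells (l :: a)|)%N.
  by rewrite card_cells // => Ld; apply: H2.
(* The cells with entry at most v are counted separately in the first row and below it. *)
have split_rank v : rank (cells (l :: a)) T v = (seg l g v + rank P T v)%N.
  rewrite /rank -!sum1_card; under eq_bigl => c do rewrite inE.
  under [in RHS]eq_bigl => c do rewrite !inE.
  rewrite (bigID (fun c : grid _ => c.1 == 0%N :> nat)) /=; congr (_ + _)%N; last first.
    by apply: eq_bigl => c; rewrite lt0n -!andbA [(_ <= _)%N && _]andbC.
  under eq_bigl => c do rewrite -andbA.
  rewrite big_mkcondr.
  rewrite (sum_cells (fun i j => if (g i j <= v)%N && (i == 0%N) then 1%N else 0%N) lam0).
  rewrite big_ord_recl /= [X in (_ + X)%N]big1 ?addn0 => [|i _]; last first.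
    by rewrite big1 // => j _; rewrite andbF.
  rewrite /seg -sum1_card big_mkcond [RHS]big_mkcond /=.
  by apply: eq_bigr => j _; rewrite !inE andbT.
have cardP : #|P| = sumn a by rewrite card_cells0 //= addKn.
have injP : {in P &, injective T}.
  by move=> c d /andP [Lc _] /andP [Ld _]; apply: injT.
rewrite -cardP -(sum_rank injP).
transitivity (\sum_(c | P c) (rank P T (T c) + (seg l g (T c)).-1))%N.
  apply: eq_bigr => -[i c] /andP [L i0].
  have := rank_values injT bT L; rewrite split_rank.
  (* Positivity lets the predecessor be taken on the segment number, so that the ranks sum to the
     binomial coefficient. *)
  have : (0 < seg l g (T (i, c)))%N.
    have cl : (c < l)%N := inshape_up sl (leq0n i) L.
    apply/card_gt0P; exists (Ordinal cl); rewrite inE /T /=.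
    by apply/ltnW/H5.
  by rewrite -/(T (i, c)); lia.
rewrite big_split /=; congr (_ + _)%N.
rewrite big_mkcondr (sum_cells (fun i j => if (0 < i)%N then (seg l g (g i j)).-1 else 0%N) lam0).
rewrite big_ord_recl /= big1 // add0n; apply: eq_bigr => i _.
have le : (nth 0 a i <= l)%N := @sorted_geq_nth (l :: a) 0 i.+1 sl isT.
rewrite (big_ord_widen l (fun j => (seg l g (g i.+1 j)).-1) le) big_mkcond /=.
by apply: eq_bigr => j _; rewrite /segtab /inshape; case: ifP.
Qed.

Theorem f_poly_rstab l a : sorted geq (l :: a) -> all (fun p => 0 < p)%N (l :: a) ->
  f_poly (l :: a) (sumn (l :: a) - l) =
  'X^('C((sumn a).+1, 2)) * rstab_sum l l l (fun i : 'I_(size a) => nth 0%N a i).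
Proof.
move=> sl lam0; have sa : sorted geq a := path_sorted sl.
have al : (nth 0 a 0 <= l)%N := @sorted_geq_nth (l :: a) 0 1 sl isT.
rewrite /f_poly /rstab_sum big_distrr; set n := sumn _.
pose F (T : {ffun grid n -> 'I_n.+1}) := filling (size a) l l (segtab l a (entry T)).
pose G (S : {ffun 'I_(size a) * 'I_l -> 'I_l.+1}) : {ffun grid n -> 'I_n.+1} :=
  filling n n n (standard l a (entry S)).
have sytP T : reflect (syt_fun (l :: a) (entry T) /\ maxdes (l :: a) (entry T))
    (isSYT (l :: a) T && (des n T == n - l)%N).
  apply: (iffP andP) => [[/(isSYT_syt_fun _ sl lam0) gP]|[gP mg]].
    by case: (desE sl lam0 gP) => /= -> _.
  by split; [apply/(isSYT_syt_fun _ sl lam0)|case: (desE sl lam0 gP) => /= ->].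
have rsP (S : {ffun 'I_(size a) * 'I_l -> 'I_l.+1}) := @rstab_rs_fun a l l l S sa al.
have entryF T : rs_fun (inshape a) l (segtab l a (entry T)) ->
    forall i c, entry (F T) i c = segtab l a (entry T) i c.
  case=> H1 H2 _ _ i c; have [L|nL] := boolP (inshape a i c); last first.
    rewrite (H1 _ _ nL); case: (boolP ((i < size a) && (c < l))%N) => [|/entry_out -> //].
    by case/andP=> ia cl; rewrite entry_filling // H1.
  have /andP [_ le] := H2 _ _ L; rewrite entry_filling // ?(inshape_row L) //.
  exact: leq_trans L (leq_trans (sorted_geq_nth sa (leq0n _)) al).
have entryG S : rs_fun (inshape a) l (entry S) ->
    forall i c, entry (G S) i c = standard l a (entry S) i c.
  move=> hP i c; have [H1 H2 _ _ _] := standard_syt_fun sl lam0 hP.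
  have [L|nL] := boolP (inshape (l :: a) i c); last first.
    rewrite (H1 _ _ nL); case: (boolP ((i < n) && (c < n))%N) => [|/entry_out -> //].
    by case/andP=> ia cl; rewrite entry_filling // H1.
  have /andP [_ le] := H2 _ _ L; have [iK cK] := inshape_bound lam0 L.
  by rewrite entry_filling.
(* The fillings [F T] and [G S] agree with [segtab] and [standard] only pointwise, so extensionality
   is proved for both constructions. *)
have eq_standard h h' i c : (forall i c, h i c = h' i c) ->
    standard l a h i c = standard l a h' i c.
  move=> hh'; rewrite /standard; case: ifP => // _.
  have kk' j d : key (size (l :: a)) h j d = key (size (l :: a)) h' j d.
    by rewrite /key; case: j => //= j; rewrite hh'.
  by rewrite kk'; apply: eq_card => d; rewrite !inE kk'.
have eq_segtab g g' i c : (forall i c, g i c = g' i c) -> segtab l a g i c = segtab l a g' i c.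
  move=> gg'; rewrite /segtab gg'; case: ifP => // _.
  by apply: eq_card => j; rewrite !inE gg'.
rewrite (reindex_onto G F) /= => [|T /sytP [gP mg]]; last first.
  apply: filling_entry => i c _ _; rewrite -[RHS](segtabK i c sl lam0 gP mg).
  by apply: eq_standard => j d; apply/entryF/segtab_rs_fun.
have tE S : isSYT (l :: a) (G S) && (des n (G S) == (n - l)%N) && (F (G S) == S)
    = rstab l (fun i : 'I_(size a) => nth 0%N a i) S.
  apply/andP/(rsP S) => [[/sytP [gP mg] /eqP FG]|hP].
    have rs := segtab_rs_fun sl lam0 gP mg.
    by rewrite -FG; apply: (eq_rs_fun _ rs) => i c; rewrite entryF.
  have E := entryG _ hP; split.
    apply/sytP; split.
      by apply: (eq_syt_fun _ (standard_syt_fun sl lam0 hP)) => i c; rewrite E.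
    by move=> i c j d; rewrite !E; apply: standard_maxdes.
  apply/eqP/filling_entry => i c _ _; rewrite -[RHS](standardK i c sl lam0 hP).
  exact: eq_segtab.
apply: eq_big => [S|S]; first exact: tE.
move=> H; have := H; rewrite tE => /(rsP S) hP.
case/andP: H => /sytP [gP mg] /eqP FG.
case: (desE sl lam0 gP) => _ -> //; rewrite (segtab_weight sl lam0 gP) exprD.
congr (_ * 'X^_).
transitivity (\sum_(i < size a) \sum_(c < l) (S (i, c)).-1)%N; last first.
  by rewrite pair_bigA; apply: eq_bigr => -[].
apply: eq_bigr => i _; apply: eq_bigr => c _.
by rewrite -(entryF _ (segtab_rs_fun sl lam0 gP mg)) FG entryE.
Qed.

Theorem mainTheorem6 (n : nat) (lam : seq nat) :
  is_partition lam n -> (1 <= head 0%N lam)%N ->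
  let l1 := head 0%N lam in
  let alpha := behead lam in
  f_poly lam (n - l1) =
    'X^('C(n - l1 + 1, 2)) * schur (conjugate alpha) l1 (fun a => 'X^(a.-1))
  /\
  f_poly lam (n - l1) = 'X^('C(n - l1 + 1, 2)) * \det (detmx lam).
Proof.
case/and3P=> sl lam0 /eqP <-; case: lam sl lam0 => // l a sl lam0 _ /=.
have sa : sorted geq a := path_sorted sl.
have al i : (nth 0 a i <= l)%N := @sorted_geq_nth (l :: a) 0 i.+1 sl isT.
have /= -> := f_poly_rstab sl lam0; rewrite addKn addn1.
split; first by rewrite (@schur_conjugate_rstab a l l).
rewrite rstab_sum_det //; last by apply/wdecP => i j; apply: sorted_geq_nth.
(* Row [i.+1] of the partition is row [i] of [a], so the index shifts of [detmx] and [qdet]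
   agree. *)
congr (_ * \det _); apply/matrixP => i j.
by rewrite !mxE qelemE.
Qed.
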